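(* For $m<n$ and the space of $n$ qubits $\mathcal{Q}_n=\mathcal{Q}_{n-m}\otimes\mathcal{Q}_m$, relativized to $m$ and $n$, for semi-density matrices $\sigma,\rho$ on $\mathcal{Q}_n$, $\mathbf{d}(\mathrm{Tr}_{\mathcal{Q}_m}\sigma|\mathrm{Tr}_{\mathcal{Q}_m}\rho)<^{+}\mathbf{d}(\sigma|\rho)$.
   Context: $\mathcal{Q}_k$ is the Hilbert space of $k$ qubits and $\mathrm{Tr}_{\mathcal{Q}_m}$ the partial trace over the factor $\mathcal{Q}_m$. $U$ is a fixed universal prefix Turing machine and $\mathbf{m}(x/y)=\sum_p 2^{-\|p\|}[U_y(p)=x]$ the universal probability. A program $q$ lower computes a positive semidefinite matrix $\sigma$ if $U(q)$ outputs an increasing sequence of elementary (rational-entry) semi-density matrices converging to $\sigma$; $\underline{\mathbf{m}}(\sigma/x)=\sum\{\mathbf{m}(q/x): q\text{ lower computes }\sigma\}$. For semi-density $\rho$, $\mathcal{T}_\rho$ is the set of lower computable matrices $\nu$ with $\mathrm{Tr}\,\nu\rho\le1$, $\mathfrak{T}_\rho=\sum_{\nu\in\mathcal{T}_\rho}\underline{\mathbf{m}}(\nu/n)\nu$, and $\mathbf{d}(\sigma|\rho)=\log\mathrm{Tr}\,\mathfrak{T}_\rho\sigma$ is the deficiency of randomness. $f<^{+}g$ means $f<g+O(1)$; ''relativized to $m$ and $n$'' means these are given to $U$ on an auxiliary tape.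
   Formalization: Lower computing uses increasing elementary positive semidefinite matrices without the trace bound of semi-density matrices (with it the claim fails, as Tr νρ ≤ 1 is vacuous); Tr 𝔗_ρσ is taken termwise in [0,∞], as 𝔗_ρ may then diverge. *)

(* Defs.v *)
From HB Require Import structures.
From mathcomp Require Import all_boot all_order all_algebra spectral.
From mathcomp Require Import complex.
From mathcomp Require Import all_classical all_reals all_analysis.

Set Implicit Arguments.
Unset Strict Implicit.
Unset Printing Implicit Defensive.

Import Order.TTheory GRing.Theory Num.Theory.
Import numFieldNormedType.Exports.

Local Open Scope classical_set_scope.
Local Open Scope ring_scope.

(* Self-delimiting Turing machines: a one-way program tape of bits (only
   accessible through [Read]), a two-way read-only auxiliary tape of bits,
   finitely many two-way work tapes over a finite alphabet, and a one-way
   write-only output tape of bits. The auxiliary and work tapes are infinite to the right; moving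
   left from cell 0 leaves the head in place. *)
Variant move := MoveL | Stay | MoveR.

Definition shift (d : move) (i : nat) : nat :=
  match d with MoveL => i.-1 | Stay => i | MoveR => i.+1 end.

Variant action (state tape sym : finType) :=
  | Halt
  | Read of state & state
  | Step of state & move & {ffun tape -> sym} & (tape -> move) & option bool.
Arguments Halt {state tape sym}.
Arguments Read {state tape sym}.
Arguments Step {state tape sym}.

(* [delta s a w]: [a] is the scanned auxiliary bit ([None] on a blank cell) and
   [w] the scanned symbols of the work tapes. [Read s0 s1] consumes one
   program bit and branches on it; [Step s d w' dw o] writes [w'], moves the
   heads and appends the bit [o], if any, to the output. *)
Record machine := Machine {
  state : finType;
  tape : finType;
  sym : finType;
  blank : sym;
  start : state;
  delta : state -> option bool -> {ffun tape -> sym} -> action state tape sym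
}.

Record config (M : machine) := Config {
  cstate : state M;
  caux : nat;
  cwork : tape M -> nat -> sym M;
  chead : tape M -> nat;
  cprog : seq bool; (* the unread part of the program *)
  cout : seq bool
}.

Section Run.
Variables (M : machine) (y : seq bool).
Implicit Types c : config M.

Definition init (p : seq bool) : config M :=
  Config (start M) 0 (fun _ _ => blank M) (fun _ => 0%N) p [::].

Definition caction c : action (state M) (tape M) (sym M) :=
  delta (cstate c) (onth y (caux c)) [ffun k => cwork c k (chead c k)].

(* A machine that tries to read past the end of its program waits forever. *)
Definition step c : config M :=
  match caction c with
  | Halt => c
  | Read s0 s1 =>
      if cprog c is b :: p then
        Config (if b then s1 else s0) (caux c) (cwork c) (chead c) p (cout c)
      else c
  | Step s d w dw o =>
      Config s (shift d (caux c))
        (fun k i => if i == chead c k then w k else cwork c k i)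
        (fun k => shift (dw k) (chead c k))
        (cprog c) (if o is Some b then rcons (cout c) b else cout c)
  end.

Definition halted c : bool := if caction c is Halt then true else false.

Definition run (p : seq bool) (t : nat) : config M := iter t step (init p).

(* M_y(p) = x : M halts with output x having read exactly p. *)
Definition computes (p x : seq bool) : Prop :=
  exists t, [/\ halted (run p t), cprog (run p t) = [::] & cout (run p t) = x].

(* w is an initial segment of the (possibly infinite) output of M_y on p,
   whether or not M halts. *)
Definition emits (p w : seq bool) : Prop :=
  exists t, prefix w (cout (run p t)).

End Run.

Section PrefixFree.
Variables (M : machine) (y : seq bool).
Definition extend_prog (s : seq bool) (c : config M) :=
  Config (cstate c) (caux c) (cwork c) (chead c) (cprog c ++ s) (cout c).
Lemma step_ext s c : step y c <> c -> step y (extend_prog s c) = extend_prog s (step y c).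
Proof.
rewrite /step /extend_prog /caction /=; case: (delta _ _ _) => [//|s0 s1|] //.
by case: (cprog c).
Qed.
Lemma halted_step (c : config M) : halted y c -> step y c = c.
Proof. by rewrite /halted /step; case: caction. Qed.
Lemma run_ext p s t : halted y (run M y p t) ->
  exists2 t', (t' <= t)%N & run M y (p ++ s) t' = extend_prog s (run M y p t).
Proof.
suff H : forall t (c : config M), halted y (iter t (step y) c) ->
  exists2 t', (t' <= t)%N & iter t' (step y) (extend_prog s c) = extend_prog s (iter t (step y) c).
  by move=> h; apply: (H t (init M p)).
elim=> [|n IH] c; first by exists 0.
rewrite iterSr => h.
have [e|ne] := pselect (step y c = c).
  rewrite e in h *; have [t' lt e'] := IH _ h; exists t' => //; exact: leqW.
have [t' lt e'] := IH _ h; exists t'.+1 => //.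
by rewrite iterSr step_ext.
Qed.
Lemma computes_prefix_free p s x x' : computes M y p x -> computes M y (p ++ s) x' -> s = [::].
Proof.
move=> [t [h ep _]] [u [h' ep' _]].
have [t' _ e] := @run_ext p s t h.
have hs : halted y (run M y (p ++ s) t') by rewrite e.
have st (c : config M) k : halted y c -> iter k (step y) c = c.
  by move=> hc; elim: k => //= k ->; exact: halted_step.
have : run M y (p++s) t' = run M y (p++s) u.
  rewrite -(st _ u hs) -(st _ t' h') /run -!iterD addnC //.
by move=> e2; move: ep'; rewrite -e2 e /= ep.
Qed.
End PrefixFree.

Definition universal (U : machine) : Prop :=
  forall T : machine, exists t : seq bool, forall y p : seq bool,
    (forall x, computes U y (t ++ p) x <-> computes T y p x) /\
    (forall w, emits U y (t ++ p) w <-> emits T y p w).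

Definition code_nat (n : nat) : seq bool := rcons (nseq n true) false.

Definition code_int (z : int) : seq bool := (z < 0) :: code_nat `|z|%N.

Definition code_rat (r : rat) : seq bool :=
  code_int (numq r) ++ code_nat `|denq r|%N.

Definition code_seq (T : Type) (f : T -> seq bool) (s : seq T) : seq bool :=
  rcons (flatten [seq true :: f x | x <- s]) false.

(* (x, y) : rat * rat stands for the complex number x + iy. *)
Definition code_mx (N : nat) (A : 'M[rat * rat]_N) : seq bool :=
  code_seq (code_seq (fun z : rat * rat => code_rat z.1 ++ code_rat z.2))
    [seq [seq A i j | j <- enum 'I_N] | i <- enum 'I_N].

Section Quantum.
Variable R : realType.

Definition elementary_mx (N : nat) (A : 'M[rat * rat]_N) : 'M[R[i]]_N :=
  map_mx (fun z : rat * rat => Complex (ratr z.1) (ratr z.2)) A.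

Definition psdmx (N : nat) (A : 'M[R[i]]_N) : Prop :=
  A \is hermsymmx /\
  forall v : 'rV[R[i]]_N, 0 <= (v *m A *m map_mx Num.conj v^T) 0 0.

Definition semidensity (N : nat) (A : 'M[R[i]]_N) : Prop :=
  psdmx A /\ \tr A <= 1.

Definition mx_cvg (N : nat) (s : nat -> 'M[R[i]]_N) (A : 'M[R[i]]_N) : Prop :=
  forall i j,
    (fun l => complex.Re (s l i j)) @ \oo --> complex.Re (A i j) /\
    (fun l => complex.Im (s l i j)) @ \oo --> complex.Im (A i j).

(* In what follows, e is the content of the auxiliary tape to which everything
   is relativized. The approximations are elementary positive semidefinite
   matrices without any bound on the trace: bounding it by 1 would turn the
   condition Tr (nu rho) <= 1 in [tests] into a vacuous one. *)
Definition lower_computes (U : machine) (e q : seq bool) (N : nat)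
    (sigma : 'M[R[i]]_N) : Prop :=
  exists s : nat -> 'M[rat * rat]_N,
    [/\ forall l, emits U e q (flatten [seq code_mx (s i) | i <- iota 0 l]),
        forall l, psdmx (elementary_mx (s l)),
        forall l, psdmx (elementary_mx (s l.+1) - elementary_mx (s l)) &
        mx_cvg (fun l => elementary_mx (s l)) sigma].

Definition univ_prob (U : machine) (x y : seq bool) : \bar R :=
  \esum_(p in [set p | computes U y p x]) ((2 ^- size p)%:E)%E.

Definition lower_prob (U : machine) (e : seq bool) (N : nat)
    (sigma : 'M[R[i]]_N) (y : seq bool) : \bar R :=
  \esum_(q in [set q | lower_computes U e q sigma]) univ_prob U q (e ++ y).

Definition tests (U : machine) (e : seq bool) (N : nat) (rho : 'M[R[i]]_N) :
    set 'M[R[i]]_N :=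
  [set nu | (exists q, lower_computes U e q nu) /\ \tr (nu *m rho) <= 1].

(* Tr (T_rho sigma) for T_rho = \sum_(nu in tests rho) m(nu / k) nu. The trace is
   taken termwise because the sum diverges in some directions when rho is
   singular. *)
Definition trace_test (U : machine) (e : seq bool) (k : nat)
    (sigma rho : 'M[R[i]]_(2 ^ k)) : \bar R :=
  \esum_(nu in tests U e rho)
    (lower_prob U e nu (code_nat k) * (complex.Re (\tr (nu *m sigma)))%:E)%E.

(* The binary logarithm, with values -oo at 0 and +oo at +oo. *)
Definition deficiency (U : machine) (e : seq bool) (k : nat)
    (sigma rho : 'M[R[i]]_(2 ^ k)) : \bar R :=
  (lne (trace_test U e sigma rho) * ((ln 2)^-1)%:E)%E.

Lemma tensor_dim (m n : nat) : (m <= n)%N -> (2 ^ (n - m) * 2 ^ m = 2 ^ n)%N.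
Proof. by move=> le_mn; rewrite -expnD subnK. Qed.

(* Basis vector |i> (x) |a> of Q_(n-m) (x) Q_m = Q_n; its index is i * 2 ^ m + a. *)
Definition tensor_index (m n : nat) (le_mn : (m <= n)%N)
    (i : 'I_(2 ^ (n - m))) (a : 'I_(2 ^ m)) : 'I_(2 ^ n) :=
  cast_ord (tensor_dim le_mn) (mxvec_index i a).

Definition partial_trace (m n : nat) (le_mn : (m <= n)%N)
    (A : 'M[R[i]]_(2 ^ n)) : 'M[R[i]]_(2 ^ (n - m)) :=
  \matrix_(i, j) \sum_a A (tensor_index le_mn i a) (tensor_index le_mn j a).

End Quantum.

(* Main.v *)
Require Import Defs.
From HB Require Import structures.
From mathcomp Require Import all_boot all_order all_algebra spectral.
From mathcomp Require Import complex.
From mathcomp Require Import all_classical all_reals all_analysis.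

(* A test nu for the reduced state Tr_m rho yields the test nu (x) I for rho:
   Tr ((nu (x) I) sigma) = Tr (nu Tr_m sigma) for every sigma. It therefore
   suffices that nu (x) I has, up to a constant factor, at least the
   universal probability of nu. Two machines containing U give this. Given q
   that lower computes nu, the first one rewrites the output of U on q, a stream of
   codes of matrices A, into the codes of the matrices A (x) I; as U is universal,
   t2 ++ q lower computes nu (x) I for a fixed t2. The second one runs U with
   n - m in place of n on the auxiliary tape, and outputs t2 before the output of
   U; hence U(p) = q given n - m implies U(t1 ++ p) = t2 ++ q given n, for a fixed
   t1, and the constant is the length of t1. *)

Set Implicit Arguments.
Unset Strict Implicit.
Unset Printing Implicit Defensive.

(** The constant has to be uniform in m and n, so no machine may have them built in: both read m off
    the auxiliary tape, and t2 and t1 are fixed before m and n. The string t2 sits in the finite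
    control of the second machine, so t1 is chosen after it. Only t1 costs anything: q is weighted
    by its universal probability, not by its length, so passing from q to t2 ++ q loses no weight.
    The auxiliary tape is read-only, so the input with n - m has to be prepared on a further tape,
    which then serves as the auxiliary tape of U. The other machine faces a different obstacle: the
    output of U on q is infinite and cannot be awaited. It therefore runs U only when a further bit
    is wanted. Its control is analysed first on a complete infinite stream, and the result is then
    transferred to the stream as U produces it. *)

Definition reach (M : machine) (y : seq bool) (c c' : config M) : Prop :=
  exists t, iter t (step y) c = c'.

Lemma reach_refl M y (c : config M) : reach y c c.
Proof. by exists 0. Qed.

Lemma reach_trans M y (c2 c1 c3 : config M) :
  reach y c1 c2 -> reach y c2 c3 -> reach y c1 c3.
Proof. by move=> [t <-] [u <-]; exists (u + t); rewrite iterD. Qed.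

Lemma reach_step M y (c c2 c3 : config M) :
  step y c = c2 -> reach y c2 c3 -> reach y c c3.
Proof. by move=> <- [t <-]; exists t.+1; rewrite iterSr. Qed.

Definition counter := option (bool * bool).

Definition five {T : Type} (x1 x2 x3 x4 x5 : T) (k : counter) : T :=
  match k with
  | Some (false, false) => x1
  | Some (false, true) => x2
  | Some (true, false) => x3
  | Some (true, true) => x4
  | None => x5
  end.

(** * Machines with an embedded copy of U *)

(* A host machine contains U, an additional tape of bits and five counters. A
   counter is the position of the head on a tape with a mark in cell 0 only, so
   that testing for 0 is reading the mark. *)
Section Host.
Variables (U : machine) (Q : finType) (q0 : Q).

(* [Own q da v dv dk o]: go to state [q], move the auxiliary head by [da], write
   [v] on the bit tape and move its head by [dv], move the counters by [dk], output
   [o]. [SimIn]: one step of U, whose output goes to the bit tape. [SimOut]: one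
   step of U, whose auxiliary tape is the bit tape. *)
Variant command :=
  | Own of Q & move & option bool & move & (counter -> move) & option bool
  | SimIn
  | SimOut.

Variable ctl : Q -> option bool -> option bool -> (counter -> bool) -> command.

Definition host_state : finType := option (Q * state U).
Definition host_tape : finType := (option counter + tape U)%type.
Definition host_sym : finType := (option bool * sym U)%type.

Definition host_delta (s : host_state) (a : option bool)
    (w : {ffun host_tape -> host_sym}) : action host_state host_tape host_sym :=
  match s with
  | None => Step (Some (q0, start U)) Stay
      [ffun k : host_tape => if k is inl (Some _) then (Some true, blank U)
                 else (None, blank U)] (fun _ => Stay) None
  | Some (q, u) =>
    let v := (w (inl None)).1 in
    let wU := [ffun k : tape U => (w (inr k)).2] in
    match ctl q a v (fun k => (w (inl (Some k))).1 == Some true) with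
    | Own q' da v' dv dk o =>
        Step (Some (q', u)) da
          [ffun k : host_tape => if k is inl None then (v', blank U) else w k]
          (fun k => match k with
                    | inl None => dv | inl (Some k) => dk k | inr _ => Stay
                    end) o
    | SimIn =>
        match delta u a wU with
        | Halt => Halt
        | Read s0 s1 => Read (Some (q, s0)) (Some (q, s1))
        | Step u' d w' dw o =>
            Step (Some (q, u')) d
              [ffun k : host_tape => match k with
                         | inl None => (if o is Some b then Some b else v, blank U)
                         | inl _ => w k
                         | inr k => (None, w' k)
                         end]
              (fun k => if k is inr k then dw k else Stay) None
        end
    | SimOut =>
        match delta u v wU with
        | Halt => Halt
        | Read s0 s1 => Read (Some (q, s0)) (Some (q, s1))
        | Step u' d w' dw o =>
            Step (Some (q, u')) Stay
              [ffun k : host_tape => if k is inr k then (None, w' k) else w k]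
              (fun k => match k with
                        | inl None => d | inl _ => Stay | inr k => dw k
                        end) o
        end
    end
  end.

Definition host : machine :=
  Machine ((None, blank U) : host_sym) (None : host_state) host_delta.

(* [caux c] and [cout c] are ignored. *)
Definition conc (q : Q) (c : config U) (aux : nat) (v : nat -> option bool)
    (pos : nat) (cnt : counter -> nat) (out : seq bool) : config host :=
  @Config host (Some (q, cstate c)) aux
    (fun k i => match k with
       | inl None => (v i, blank U)
       | inl (Some _) => (if i == 0 then Some true else None, blank U)
       | inr k => (None, cwork c k i)
       end)
    (fun k => match k with
       | inl None => pos
       | inl (Some k) => cnt k
       | inr k => chead c k
       end) (cprog c) out.

Lemma config_eq (M : machine) (c c' : config M) :
  cstate c = cstate c' -> caux c = caux c' ->
  (forall k i, cwork c k i = cwork c' k i) ->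
  (forall k, chead c k = chead c' k) -> cprog c = cprog c' -> cout c = cout c' ->
  c = c'.
Proof.
case: c => ? ? w h ? ?; case: c' => ? ? w' h' ? ? /= -> -> ew eh -> ->.
by congr Config; apply/funext => k; [apply/funext => i|].
Qed.

(** All tapes start blank, so the extra state [None] spends one step on writing the marks in the
    cells 0 of the counters. *)
Lemma step_host_init y p :
  step y (init host p) =
  conc q0 (init U p) 0 (fun=> None) 0 (five 0 0 0 0 0) [::].
Proof.
rewrite /step /caction /=; apply: config_eq => //=.
- by move=> [[k|]|k] i; rewrite ?ffunE //=; case: (i == 0).
- by move=> [[[[[] []]|]|]|k].
Qed.

Variables (y : seq bool) (q : Q) (c : config U) (aux : nat).
Variables (v : nat -> option bool) (pos : nat) (cnt : counter -> nat).
Variable out : seq bool.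

Lemma host_delta_conc :
  caction y (conc q c aux v pos cnt out) =
  let wU := [ffun k : tape U => cwork c k (chead c k)] in
  let w := [ffun k => cwork (conc q c aux v pos cnt out) k
                            (chead (conc q c aux v pos cnt out) k)] in
    match ctl q (onth y aux) (v pos) (fun k => cnt k == 0) with
    | Own q' da v' dv dk o =>
        Step (Some (q', cstate c)) da
          [ffun k : host_tape => if k is inl None then (v', blank U) else w k]
          (fun k => match k with
                    | inl None => dv | inl (Some k) => dk k | inr _ => Stay
                    end) o
    | SimIn =>
        match delta (cstate c) (onth y aux) wU with
        | Halt => Halt
        | Read s0 s1 => Read (Some (q, s0)) (Some (q, s1))
        | Step u' d w' dw o =>
            Step (Some (q, u')) d
              [ffun k : host_tape => match k with
                         | inl None => (if o is Some b then Some b else v pos, blank U)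
                         | inl _ => w k
                         | inr k => (None, w' k)
                         end]
              (fun k => if k is inr k then dw k else Stay) None
        end
    | SimOut =>
        match delta (cstate c) (v pos) wU with
        | Halt => Halt
        | Read s0 s1 => Read (Some (q, s0)) (Some (q, s1))
        | Step u' d w' dw o =>
            Step (Some (q, u')) Stay
              [ffun k : host_tape => if k is inr k then (None, w' k) else w k]
              (fun k => match k with
                        | inl None => d | inl _ => Stay | inr k => dw k
                        end) o
        end
    end.
Proof.
rewrite /caction /= !ffunE /=.
set wU := [ffun k => _.2]; set wU' := [ffun k => cwork c k _].
have -> : wU = wU' by apply/ffunP => k; rewrite !ffunE.
set z := fun k => _; have -> : z = (fun k => cnt k == 0).
  by apply/funext => k; rewrite /z ffunE /=; case: (cnt k == 0).
by [].
Qed.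

Lemma step_own q' da v' dv dk o c' :
  ctl q (onth y aux) (v pos) (fun k => cnt k == 0) = Own q' da v' dv dk o ->
  conc q' c (Defs.shift da aux) (fun i => if i == pos then v' else v i)
    (Defs.shift dv pos) (fun k => Defs.shift (dk k) (cnt k))
    (if o is Some b then rcons out b else out) = c' ->
  step y (conc q c aux v pos cnt out) = c'.
Proof.
move=> e <-; rewrite /step host_delta_conc e /=; apply: config_eq => //=.
- move=> [[k|]|k] i; rewrite ?ffunE /=; case: eqP => [e0|ne] //; rewrite ?e0 ?ffunE //=.
- by move=> [[k|]|k].
Qed.

End Host.

(** * One step of the host against one step of U *)

Section Simulation.
Variables (U : machine) (Q : finType) (q0 : Q).
Variable ctl :
  Q -> option bool -> option bool -> (counter -> bool) -> command Q.
Variables (y : seq bool) (q : Q) (c : config U) (cnt : counter -> nat).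

Lemma onth_rcons T (s : seq T) b i :
  onth (rcons s b) i = if i == size s then Some b else onth s i.
Proof. by elim: s i => [|x s IH] [|i] //=; case: i. Qed.

Lemma onth_size T (s : seq T) : onth s (size s) = None.
Proof. by elim: s. Qed.

(** The head on the bit tape does not move: a bit that U emits lands under it, and the next step of
    the host finds a non-blank cell. *)
Lemma step_simin out :
  ctl q (onth y (caux c)) None (fun k => cnt k == 0) = SimIn Q ->
  step y (conc q0 ctl q c (caux c) (onth (cout c)) (size (cout c)) cnt out) =
  conc q0 ctl q (step y c) (caux (step y c)) (onth (cout (step y c)))
    (size (cout c)) cnt out.
Proof.
move=> e; rewrite [LHS]/step host_delta_conc onth_size e /= /step /caction.
case: delta => [|s0 s1|u' d w' dw o] //=.
  by case: (cprog c) => //= b p; case: b.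
apply: config_eq => //=.
- move=> [[k|]|k] i; rewrite ?ffunE /=; case: eqP => [e0|ne] //; rewrite ?e0 ?ffunE //.
  + by case: o => [b|]; rewrite ?onth_rcons ?onth_size // eqxx.
  + by case: o => [b|] //; rewrite onth_rcons; case: eqP ne.
- by move=> [[k|]|k].
Qed.

Lemma step_simout y' aux pre :
  ctl q (onth y aux) (onth y' (caux c)) (fun k => cnt k == 0) = SimOut Q ->
  step y (conc q0 ctl q c aux (onth y') (caux c) cnt (pre ++ cout c)) =
  conc q0 ctl q (step y' c) aux (onth y') (caux (step y' c)) cnt
    (pre ++ cout (step y' c)).
Proof.
move=> e; rewrite [LHS]/step host_delta_conc e /= /step /caction.
case: delta => [|s0 s1|u' d w' dw o] //=.
  by case: (cprog c) => //= b p; case: b.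
apply: config_eq => //=.
- by move=> [[k|]|k] i; rewrite ?ffunE /=; case: eqP => [e0|ne] //; rewrite ?e0 ?ffunE.
- by move=> [[k|]|k].
- by case: o => // b; rewrite rcons_cat.
Qed.

Lemma halted_simout y' aux out :
  ctl q (onth y aux) (onth y' (caux c)) (fun k => cnt k == 0) = SimOut Q ->
  halted y (conc q0 ctl q c aux (onth y') (caux c) cnt out) = halted y' c.
Proof.
move=> e; rewrite /halted host_delta_conc e /= /caction.
by case: delta.
Qed.

End Simulation.

Lemma drop_onth (T : Type) (y : seq T) i b r :
  drop i y = b :: r -> onth y i = Some b /\ drop i.+1 y = r.
Proof. by elim: y i => [|x y IH] [|i] //=; [case=> -> ->; rewrite drop0|exact: IH]. Qed.

Lemma onth_update (T : Type) (s : seq T) b :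
  (fun i => if i == size s then Some b else onth s i) = onth (rcons s b).
Proof. by apply/funext => i; rewrite onth_rcons. Qed.

Lemma onth_id (T : Type) (v : nat -> option T) p :
  (fun i => if i == p then v p else v i) = v.
Proof. by apply/funext => i; case: eqP => [->|]. Qed.

Lemma shift_five d1 d2 d3 d4 d5 n1 n2 n3 n4 n5 :
  (fun k => Defs.shift (five d1 d2 d3 d4 d5 k) (five n1 n2 n3 n4 n5 k)) =
  five (Defs.shift d1 n1) (Defs.shift d2 n2) (Defs.shift d3 n3)
    (Defs.shift d4 n4) (Defs.shift d5 n5).
Proof. by apply/funext => -[[[] []]|]. Qed.

Lemma five_zero n1 n2 n3 n4 n5 :
  (fun k => five n1 n2 n3 n4 n5 k == 0) =
  five (n1 == 0) (n2 == 0) (n3 == 0) (n4 == 0) (n5 == 0).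
Proof. by apply/funext => -[[[] []]|]. Qed.

Lemma drop_code_nat0 y i r :
  drop i y = code_nat 0 ++ r -> onth y i = Some false /\ drop i.+1 y = r.
Proof. exact: drop_onth. Qed.

Lemma drop_code_natS y i k r : drop i y = code_nat k.+1 ++ r ->
  onth y i = Some true /\ drop i.+1 y = code_nat k ++ r.
Proof. exact: drop_onth. Qed.

(** * Changing the auxiliary input *)

Section ChangeAux.
Variables (U : machine) (pre : seq bool).

(** The four pairs of booleans are the phases of preparing the bit tape: one for each of the three
    blocks, then the rewinding. [inl i] means that i bits of [pre] have been output; at i =
    [size pre] U takes over. *)
Definition aux_state : finType := ('I_(size pre).+1 + bool * bool)%type.

Definition copy_head (q : aux_state) (b : bool) (da : move) : command aux_state :=
  Own q MoveR (Some b) MoveR (five da Stay Stay Stay MoveR) None.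

(* On the auxiliary input 1^m 0 1^n 0 1^n 0, the first counter remembers m, which is
   then subtracted from the last block; the fifth counter is the position on the bit
   tape. *)
Definition aux_ctl (q : aux_state) (a v : option bool) (z : counter -> bool) :
    command aux_state :=
  match q with
  | inl i =>
      if (i < size pre)%N
      then Own (inl (inord i.+1)) Stay v Stay (five Stay Stay Stay Stay Stay)
             (Some (nth false pre i))
      else SimOut _
  | inr (false, false) =>
      if a is Some true then copy_head q true MoveR
      else copy_head (inr (false, true)) false Stay
  | inr (false, true) =>
      if a is Some true then copy_head q true Stay
      else copy_head (inr (true, false)) false Stay
  | inr (true, false) =>
      if a is Some true then
        if z (Some (false, false)) then copy_head q true Stay
        else Own q MoveR v Stay (five MoveL Stay Stay Stay Stay) None
      else copy_head (inr (true, true)) false Stay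
  | inr (true, true) =>
      if z None then
        Own (inl ord0) Stay v Stay (five Stay Stay Stay Stay Stay) None
      else Own q Stay v MoveL (five Stay Stay Stay Stay MoveL) None
  end.

Definition aux_machine := host U ((inr (false, false)) : aux_state) aux_ctl.

Variables (y : seq bool) (c : config U).

Let C (q : aux_state) aux s a : config aux_machine :=
  conc _ aux_ctl q c aux (onth s) (size s) (five a 0 0 0 (size s)) [::].

Let step_copy q q' aux s a a' b da :
  aux_ctl q (onth y aux) None (five (a == 0) true true true (size s == 0)) =
    copy_head q' b da ->
  a' = Defs.shift da a ->
  step y (C q aux s a) = C q' aux.+1 (rcons s b) a'.
Proof.
move=> e ->; rewrite /C; apply: step_own; first by rewrite onth_size five_zero /= e.
by rewrite onth_update size_rcons shift_five.
Qed.

Lemma reach_copy1 k r aux s a : drop aux y = code_nat k ++ r ->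
  reach y (C (inr (false, false)) aux s a)
    (C (inr (false, true)) (aux + k.+1) (s ++ code_nat k) (a + k)).
Proof.
elim: k aux s a => [|k IH] aux s a.
  move=> /drop_code_nat0[e _]; rewrite addn1 addn0 cats1.
  by apply: reach_step (reach_refl _ _); apply: step_copy; [rewrite e|].
move=> /drop_code_natS[e /IH h].
rewrite -cat_rcons addnS -addSn -[a + k.+1]addSnnS.
by apply: reach_step (h _ _); apply: step_copy; [rewrite e|].
Qed.

Lemma reach_copy2 k r aux s a : drop aux y = code_nat k ++ r ->
  reach y (C (inr (false, true)) aux s a)
    (C (inr (true, false)) (aux + k.+1) (s ++ code_nat k) a).
Proof.
elim: k aux s => [|k IH] aux s.
  move=> /drop_code_nat0[e _]; rewrite addn1 cats1.
  by apply: reach_step (reach_refl _ _); apply: step_copy; [rewrite e|].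
move=> /drop_code_natS[e /IH h].
rewrite -cat_rcons addnS -addSn.
by apply: reach_step (h _); apply: step_copy; [rewrite e|].
Qed.

(** The first [a] marks of the block only lower the counter, the next [k] are copied. The final
    auxiliary position may stay unspecified, since U will read the bit tape instead. *)
Lemma reach_copy3 k r aux s a : drop aux y = code_nat (a + k) ++ r ->
  exists aux', reach y (C (inr (true, false)) aux s a)
    (C (inr (true, true)) aux' (s ++ code_nat k) 0).
Proof.
elim: a aux => [|a IH] aux.
  elim: k aux s => [|k IH] aux s.
    move=> /drop_code_nat0[e _]; exists aux.+1; rewrite cats1.
    by apply: reach_step (reach_refl _ _); apply: step_copy; [rewrite e|].
  rewrite add0n => /drop_code_natS[e /IH h].
  have [aux' {}h] := h (rcons s true); exists aux'.
  rewrite -cat_rcons.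
  by apply: reach_step h; apply: step_copy; [rewrite e|].
rewrite addSn => /drop_code_natS[e /IH [aux' h]]; exists aux'.
apply: reach_step h; rewrite /C; apply: step_own.
  by rewrite onth_size five_zero /= e.
by rewrite -{1}(onth_size s) onth_id shift_five.
Qed.

(** A head cannot notice that it is in cell 0; the fifth counter, which moves along with it,
    tells. *)
Lemma reach_rewind aux v k :
  reach y (conc (inr (false, false) : aux_state) aux_ctl (inr (true, true)) c aux v
             k (five 0 0 0 0 k) [::])
    (conc _ aux_ctl (inl ord0) c aux v 0 (five 0 0 0 0 0) [::]).
Proof.
elim: k => [|k IH]; [apply: reach_step (reach_refl _ _)|apply: reach_step IH].
all: apply: step_own; first by rewrite five_zero /=.
all: by rewrite onth_id shift_five.
Qed.

Lemma reach_prefix aux v :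
  reach y (conc (inr (false, false) : aux_state) aux_ctl (inl ord0) c aux v 0
             (five 0 0 0 0 0) [::])
    (conc _ aux_ctl (inl ord_max) c aux v 0 (five 0 0 0 0 0) pre).
Proof.
suff H k : (k <= size pre)%N ->
  reach y (conc (inr (false, false) : aux_state) aux_ctl (inl ord0) c aux v 0
             (five 0 0 0 0 0) [::])
    (conc _ aux_ctl (inl (inord k)) c aux v 0 (five 0 0 0 0 0) (take k pre)).
  have := H _ (leqnn _); rewrite take_size.
  by rewrite (_ : inord (size pre) = ord_max) //; apply/val_inj; rewrite /= inordK.
elim: k => [|k IH] lek.
  rewrite take0 (_ : inord 0 = ord0); first exact: reach_refl.
  by apply/val_inj; rewrite /= inordK.
apply: reach_trans (IH (ltnW lek)) _.
apply: reach_step (reach_refl _ _).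
apply: step_own; first by rewrite /= inordK ?lek //; exact: leqW.
rewrite onth_id shift_five -take_nth //.
Qed.

End ChangeAux.

(** The host consumes program bits only through U, and none before U starts. From then on the two
    run in lockstep, so they halt together with the same part of the program read. *)
Lemma aux_machine_computes U pre m n e p x : (m <= n)%N ->
  e = code_nat m ++ code_nat n ->
  computes U (e ++ code_nat (n - m)) p x ->
  computes (aux_machine U pre) (e ++ code_nat n) p (pre ++ x).
Proof.
move=> le_mn ee [t [ht pt ot]].
set y := e ++ code_nat n; set y' := e ++ code_nat (n - m).
set q0 : aux_state pre := inr (false, false).
have [aux h] : exists aux, reach y (init (aux_machine U pre) p)
   (conc q0 (@aux_ctl pre) (inl ord_max) (init U p) aux (onth y') 0
      (five 0 0 0 0 0) (pre ++ [::])).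
  have [aux h] : exists aux, reach y (conc q0 (@aux_ctl pre) q0 (init U p) 0
      (onth [::]) (size ([::] : seq bool)) (five 0 0 0 0 (size ([::] : seq bool))) [::])
     (conc q0 (@aux_ctl pre) (inr (true, true)) (init U p) aux (onth y') (size y')
      (five 0 0 0 0 (size y')) [::]).
    have e1 : drop 0 y = code_nat m ++ (code_nat n ++ code_nat n).
      by rewrite drop0 /y ee catA.
    have szc k : size (code_nat k) = k.+1 by rewrite size_rcons size_nseq.
    have e2 : drop (0 + m.+1) y = code_nat n ++ code_nat n.
      by rewrite /y ee -catA drop_size_cat // szc.
    (* The last block is split as n = m + (n - m), the counter being m when it is reached. *)
    have e3 : drop (0 + m.+1 + n.+1) y = code_nat (0 + m + (n - m)) ++ [::].
      by rewrite cats0 add0n subnKC // /y ee drop_size_cat // size_cat !szc.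
    have h1 := reach_copy1 pre (init U p) [::] 0 e1.
    have h2 := reach_copy2 pre (init U p) ([::] ++ code_nat m) (0 + m) e2.
    have [aux h3] := reach_copy3 pre (init U p) (([::] ++ code_nat m) ++ code_nat n) e3.
    exists aux; apply: reach_trans h1 _; apply: reach_trans h2 _.
    by rewrite /y' ee.
  exists aux; apply: reach_step; first exact: step_host_init.
  rewrite (_ : (fun=> None) = onth [::]); last by apply/funext => i; rewrite onth0n.
  apply: reach_trans h _; apply: reach_trans (reach_rewind _ _ _ _ _ _) _.
  by rewrite cats0; exact: reach_prefix.
have {h} [t1 h] := h.
have ctlE a v z : @aux_ctl pre (inl ord_max) a v z = SimOut _.
  by rewrite /= ltnn.
have run k : run (aux_machine U pre) y p (k + t1) =
   conc q0 (@aux_ctl pre) (inl ord_max) (run U y' p k) aux (onth y')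
      (caux (run U y' p k)) (five 0 0 0 0 0) (pre ++ cout (run U y' p k)).
  rewrite /run iterD h; elim: k => //= k ->.
  by apply: step_simout; rewrite ctlE.
exists (t + t1)%N; rewrite run; split => //=; last by rewrite ot.
by rewrite halted_simout // ctlE.
Qed.

(** * Transforming codes of matrices A into codes of A (x) I *)

(** [Zero s x y z] writes the eight-bit code of 0 + 0i, with x y z as a binary counter of the bits
    written and s telling which side of the entry is being filled. [Copy h k] copies an entry: h is
    false in the real and true in the imaginary part, and k is [None] at the sign, [Some false] in
    the numerator, [Some true] in the denominator. *)
Variant tensor_state :=
  | PLoop | PDouble | PBack | PRewind
  | MatScan | RowScan | ZeroL | ZeroR | Restore | RowEnd | Rewind | Reset
  | Zero of bool & bool & bool & bool
  | Copy of bool & option bool.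

Definition tensor_code : finType :=
  (bool * bool + bool * bool * bool + bool * bool * bool * bool
   + bool * option bool)%type.

Definition tensor_enc (q : tensor_state) : tensor_code :=
  match q with
  | PLoop => inl (inl (inl (false, false)))
  | PDouble => inl (inl (inl (false, true)))
  | PBack => inl (inl (inl (true, false)))
  | PRewind => inl (inl (inl (true, true)))
  | MatScan => inl (inl (inr (false, false, false)))
  | RowScan => inl (inl (inr (false, false, true)))
  | ZeroL => inl (inl (inr (false, true, false)))
  | ZeroR => inl (inl (inr (false, true, true)))
  | Restore => inl (inl (inr (true, false, false)))
  | RowEnd => inl (inl (inr (true, false, true)))
  | Rewind => inl (inl (inr (true, true, false)))
  | Reset => inl (inl (inr (true, true, true)))
  | Zero s x y z => inl (inr (s, x, y, z))
  | Copy h k => inr (h, k)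
  end.

Definition tensor_dec (x : tensor_code) : tensor_state :=
  match x with
  | inl (inl (inl (false, false))) => PLoop
  | inl (inl (inl (false, true))) => PDouble
  | inl (inl (inl (true, false))) => PBack
  | inl (inl (inl (true, true))) => PRewind
  | inl (inl (inr (false, false, false))) => MatScan
  | inl (inl (inr (false, false, true))) => RowScan
  | inl (inl (inr (false, true, false))) => ZeroL
  | inl (inl (inr (false, true, true))) => ZeroR
  | inl (inl (inr (true, false, false))) => Restore
  | inl (inl (inr (true, false, true))) => RowEnd
  | inl (inl (inr (true, true, false))) => Rewind
  | inl (inl (inr (true, true, true))) => Reset
  | inl (inr (s, x, y, z)) => Zero s x y z
  | inr (h, k) => Copy h k
  end.

Lemma tensor_encK : cancel tensor_enc tensor_dec. Proof. by case. Qed.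

HB.instance Definition _ := Finite.copy tensor_state (can_type tensor_encK).

Local Notation cL := (Some (false, false)).
Local Notation cL' := (Some (false, true)).
Local Notation cR := (Some (true, false)).
Local Notation cR' := (Some (true, true)).
Local Notation cP := None.

Definition stays : counter -> move := five Stay Stay Stay Stay Stay.

(* Row i * 2^m + a of A (x) I is row i of A with each entry preceded by a zeros and
   followed by 2^m - 1 - a zeros. The counters cL and cR hold these two numbers
   (while the zeros are written they are moved to cL' and cR'), and cP is the
   distance from the beginning of row i of A, which is read once for each a. *)
Definition main_ctl (q : tensor_state) (b : bool) (z : counter -> bool) :
    tensor_state * move * (counter -> move) * option bool :=
  match q with
  | MatScan => if b then (RowScan, MoveR, stays, Some true)
               else (MatScan, MoveR, stays, Some false)
  | RowScan => if b then (ZeroL, MoveR, five Stay Stay Stay Stay MoveR, None)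
               else (RowEnd, Stay, stays, Some false)
  | RowEnd => if z cR then (Reset, Stay, stays, None)
              else (Rewind, Stay, five MoveR Stay MoveL Stay Stay, None)
  | Rewind => if z cP then (RowScan, Stay, stays, Some true)
              else (Rewind, MoveL, five Stay Stay Stay Stay MoveL, None)
  | Reset => if z cL && z cP then (MatScan, MoveR, stays, None)
             else (Reset, Stay,
               five MoveL Stay (if z cL then Stay else MoveR) Stay MoveL, None)
  | ZeroL => if z cL then (Copy false None, Stay, stays, Some true)
             else (Zero false false false false, Stay,
               five MoveL MoveR Stay Stay Stay, Some true)
  | ZeroR => if z cR then (Restore, Stay, stays, None)
             else (Zero true false false false, Stay,
               five Stay Stay MoveL MoveR Stay, Some true)
  | Zero s x y z =>
      (if z then
         if y then
           if x then (if s then ZeroR else ZeroL) else Zero s true false false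
         else Zero s x true false
       else Zero s x y true, Stay, stays, Some (y && ~~ z))
  | Copy h k =>
      (match k with
       | None => Copy h (Some false)
       | Some d =>
           if b then q
           else if d then (if h then ZeroR else Copy true None)
           else Copy h (Some true)
       end, MoveR, five Stay Stay Stay Stay MoveR, Some b)
  | Restore =>
      if z cL' && z cR' then (RowScan, Stay, stays, None)
      else (Restore, Stay,
        five (if z cL' then Stay else MoveR) MoveL
             (if z cR' then Stay else MoveR) MoveL Stay, None)
  | _ => (q, Stay, stays, None)
  end.

Definition is_main (q : tensor_state) : bool :=
  match q with PLoop | PDouble | PBack | PRewind => false | _ => true end.

(* The states P... compute cR = 2^m - 1 from the first block 1^m 0 of the auxiliary
   tape. In the other states the bit tape holds the output of U so far: U is run
   whenever the head is on a blank cell. *)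
Definition tensor_ctl (q : tensor_state) (a v : option bool)
    (z : counter -> bool) : command tensor_state :=
  match q with
  | PLoop => Own (if a is Some true then PDouble else PRewind) Stay v Stay stays None
  | PDouble =>
      if z cR then Own PBack Stay v Stay stays None
      else Own PDouble Stay v Stay (five Stay MoveR MoveL MoveR Stay) None
  | PBack =>
      if z cL' then
        if z cR' then Own PLoop MoveR v Stay (five Stay Stay MoveR Stay MoveR) None
        else Own PBack Stay v Stay (five Stay Stay MoveR MoveL Stay) None
      else Own PBack Stay v Stay (five Stay MoveL MoveR Stay Stay) None
  | PRewind =>
      if z cP then Own MatScan Stay v Stay stays None
      else Own PRewind MoveL v Stay (five Stay Stay Stay Stay MoveL) None
  | _ =>
      if v is Some b then
        let: (q', dv, dk, o) := main_ctl q b z in Own q' Stay v dv dk o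
      else SimIn _
  end.

(* The run of [tensor_ctl] on an already completed stream [w] of bits. *)
Record sconf := SConf {
  sq : tensor_state; spos : nat;
  sL : nat; sL' : nat; sR : nat; sR' : nat; sP : nat; sout : seq bool }.

Definition sstep (w : nat -> bool) (x : sconf) : sconf :=
  let: (q', dv, dk, o) := main_ctl (sq x) (w (spos x))
    (five (sL x == 0) (sL' x == 0) (sR x == 0) (sR' x == 0) (sP x == 0)) in
  SConf q' (Defs.shift dv (spos x)) (Defs.shift (dk cL) (sL x))
    (Defs.shift (dk cL') (sL' x)) (Defs.shift (dk cR) (sR x))
    (Defs.shift (dk cR') (sR' x)) (Defs.shift (dk cP) (sP x))
    (if o is Some b then rcons (sout x) b else sout x).

Definition code_body (T : Type) (f : T -> seq bool) (s : seq T) : seq bool :=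
  flatten [seq true :: f x | x <- s].

Lemma code_body_cat T (f : T -> seq bool) s1 s2 :
  code_body f (s1 ++ s2) = code_body f s1 ++ code_body f s2.
Proof. by rewrite /code_body map_cat flatten_cat. Qed.

Lemma code_body_cons T (f : T -> seq bool) x s :
  code_body f (x :: s) = true :: f x ++ code_body f s.
Proof. by []. Qed.

Lemma code_seq_cons T (f : T -> seq bool) x s :
  code_seq f (x :: s) = true :: f x ++ code_seq f s.
Proof. by rewrite /code_seq /= rcons_cat. Qed.

Lemma code_seq_cat T (f : T -> seq bool) s1 s2 :
  code_seq f (s1 ++ s2) = code_body f s1 ++ code_seq f s2.
Proof. by rewrite /code_seq map_cat flatten_cat rcons_cat. Qed.

Lemma size_code_seq T (f : T -> seq bool) s :
  size (code_seq f s) = (size (code_body f s)).+1.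
Proof. by rewrite size_rcons. Qed.

Definition code_entry (z : rat * rat) : seq bool := code_rat z.1 ++ code_rat z.2.
Definition zero_entry : rat * rat := (0, 0)%R.

Lemma code_zero_entry : code_entry zero_entry =
  [:: false; false; true; false; false; false; true; false].
Proof. by rewrite /code_entry /code_rat (numq_int 0) (denq_int 0). Qed.

(* One row of [A (x) I], made from the row [s] of [A], where [i + j + 1] is the
   dimension of [I]. *)
Definition spread_row (i j : nat) (s : seq (rat * rat)) : seq (rat * rat) :=
  flatten [seq nseq i zero_entry ++ z :: nseq j zero_entry | z <- s].

Definition spread_rows (k : nat) (rows : seq (seq (rat * rat))) :=
  flatten [seq [seq spread_row i (k - i) s | i <- iota 0 k.+1] | s <- rows].

(** * The tensoring control on a complete stream of bits *)

Section Stream.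
Variable w : nat -> bool.

Definition sreach (x x' : sconf) := exists t, iter t (sstep w) x = x'.

Lemma sreach_refl x : sreach x x. Proof. by exists 0. Qed.

Lemma sreach_trans x2 x1 x3 : sreach x1 x2 -> sreach x2 x3 -> sreach x1 x3.
Proof. by move=> [t <-] [u <-]; exists (u + t); rewrite iterD. Qed.

Lemma sreach_step x x2 x3 : sstep w x = x2 -> sreach x2 x3 -> sreach x x3.
Proof. by move=> <- [t <-]; exists t.+1; rewrite iterSr. Qed.

Definition reads (pos : nat) (u : seq bool) : Prop :=
  forall i, (i < size u)%N -> w (pos + i) = nth false u i.

Lemma reads_cons pos b u : reads pos (b :: u) -> w pos = b /\ reads pos.+1 u.
Proof.
move=> h; split; first by have := h 0 isT; rewrite addn0.
by move=> i lti; rewrite addSnnS h.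
Qed.

Lemma reads_cat pos u v :
  reads pos (u ++ v) -> reads pos u /\ reads (pos + size u) v.
Proof.
move=> h; split=> i lti.
  by rewrite h ?nth_cat ?lti // size_cat ltn_addr.
by rewrite -addnA h ?nth_cat ?size_cat ?ltn_add2l // ltnNge leq_addr addKn.
Qed.

Lemma reads_code_nat0 pos : reads pos (code_nat 0) -> w pos = false.
Proof. by move=> /reads_cons[]. Qed.

Lemma reads_code_natS pos k :
  reads pos (code_nat k.+1) -> w pos = true /\ reads pos.+1 (code_nat k).
Proof. exact: reads_cons. Qed.

Lemma sreach_zero (s : bool) pos l l' r r' p out :
  sreach (SConf (Zero s false false false) pos l l' r r' p out)
    (SConf (if s then ZeroR else ZeroL) pos l l' r r' p
      (out ++ code_entry zero_entry)).
Proof.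
do 8![apply: sreach_step; first by rewrite /sstep /=].
rewrite code_zero_entry -!cats1 -!catA; exact: sreach_refl.
Qed.

(** The last [true] announces the entry of A that is copied next. *)
Lemma sreach_zeroL pos l l' r r' p out :
  sreach (SConf ZeroL pos l l' r r' p out)
    (SConf (Copy false None) pos 0 (l' + l) r r' p
      (out ++ code_body code_entry (nseq l zero_entry) ++ [:: true])).
Proof.
elim: l l' out => [|l IH] l' out.
  by apply: sreach_step (sreach_refl _); rewrite /sstep /= addn0 cats1.
apply: sreach_step; first by rewrite /sstep /=.
apply: sreach_trans (sreach_zero false _ _ _ _ _ _ _) _.
have := IH l'.+1 (rcons out true ++ code_entry zero_entry).
by rewrite addSnnS -cats1 -!catA.
Qed.

Lemma sreach_zeroR pos l l' r r' p out :
  sreach (SConf ZeroR pos l l' r r' p out)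
    (SConf Restore pos l l' 0 (r' + r) p
      (out ++ code_body code_entry (nseq r zero_entry))).
Proof.
elim: r r' out => [|r IH] r' out.
  by apply: sreach_step (sreach_refl _); rewrite /sstep /= addn0 cats0.
apply: sreach_step; first by rewrite /sstep /=.
apply: sreach_trans (sreach_zero true _ _ _ _ _ _ _) _.
have := IH r'.+1 (rcons out true ++ code_entry zero_entry).
by rewrite addSnnS -cats1 -!catA.
Qed.

Lemma sreach_restore pos l l' r r' p out :
  sreach (SConf Restore pos l l' r r' p out)
    (SConf RowScan pos (l + l') 0 (r + r') 0 p out).
Proof.
elim: l' l r r' => [|l' IH] l r r'.
  elim: r' l r => [|r' IH] l r; last first.
    by rewrite addnS -addSn; apply: sreach_step (IH _ _).
  by rewrite !addn0; apply: sreach_step (sreach_refl _).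
case: r' => [|r'].
  by rewrite addnS -addSn; apply: sreach_step (IH _ _ _).
by rewrite !addnS -!addSn; apply: sreach_step (IH _ _ _).
Qed.

Lemma sreach_copy_nat k pos l l' r r' p out h d : reads pos (code_nat k) ->
  sreach (SConf (Copy h (Some d)) pos l l' r r' p out)
    (SConf (if d then (if h then ZeroR else Copy true None) else Copy h (Some true))
       (pos + k.+1) l l' r r' (p + k.+1) (out ++ code_nat k)).
Proof.
elim: k pos p out => [|k IH] pos p out.
  move=> /reads_code_nat0 e; apply: sreach_step (sreach_refl _).
  by rewrite /sstep /= e !addn1 cats1.
move=> /reads_code_natS[e /IH h1].
rewrite -cat_rcons !(addnS _ k.+1) -!addSn.
by apply: sreach_step (h1 _ _); rewrite /sstep /= e.
Qed.

Lemma size_code_nat k : size (code_nat k) = k.+1.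
Proof. by rewrite size_rcons size_nseq. Qed.

Lemma sreach_copy_rat x pos l l' r r' p out h : reads pos (code_rat x) ->
  sreach (SConf (Copy h None) pos l l' r r' p out)
    (SConf (if h then ZeroR else Copy true None)
       (pos + size (code_rat x)) l l' r r' (p + size (code_rat x))
       (out ++ code_rat x)).
Proof.
rewrite /code_rat /code_int cat_cons => /reads_cons[e /reads_cat[h1 h2]].
rewrite /= size_cat !size_code_nat !addnS -!addSn -cat_rcons catA.
apply: sreach_step; first by rewrite /sstep /= e.
apply: sreach_trans (sreach_copy_nat _ _ _ _ _ _ _ _ h1) _ => /=.
rewrite size_code_nat in h2.
have := sreach_copy_nat l l' r r' (p.+1 + `|numq x|.+1) 
  (rcons out (numq x < 0)%R ++ code_nat `|numq x|) h true h2.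
by rewrite !addSn !addnS !addnA !addSn.
Qed.

Lemma sreach_copy_entry z pos l l' r r' p out : reads pos (code_entry z) ->
  sreach (SConf (Copy false None) pos l l' r r' p out)
    (SConf ZeroR (pos + size (code_entry z)) l l' r r' (p + size (code_entry z))
       (out ++ code_entry z)).
Proof.
move=> /reads_cat[h1 h2]; rewrite /code_entry size_cat !addnA catA.
apply: sreach_trans (sreach_copy_rat _ _ _ _ _ _ _ h1) _.
exact: sreach_copy_rat.
Qed.

(** The head stops on the end mark of the row without passing it, hence [code_body] in the position
    but [code_seq] in the output. Position and [p] grow alike, which makes the rewinding exact. *)
Lemma sreach_row s pos l r p out : reads pos (code_seq code_entry s) ->
  sreach (SConf RowScan pos l 0 r 0 p out)
    (SConf RowEnd (pos + size (code_body code_entry s)) l 0 r 0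
       (p + size (code_body code_entry s))
       (out ++ code_seq code_entry (spread_row l r s))).
Proof.
elim: s pos p out => [|z s IH] pos p out.
  move=> /reads_cons[e _]; apply: sreach_step (sreach_refl _).
  by rewrite /sstep /= e !addn0 cats1.
rewrite code_seq_cons => /reads_cons[e /reads_cat[h1 /IH h2]].
apply: sreach_step; first by rewrite /sstep /= e.
apply: sreach_trans (sreach_zeroL _ _ _ _ _ _ _) _.
apply: sreach_trans (sreach_copy_entry _ _ _ _ _ _ h1) _.
apply: sreach_trans (sreach_zeroR _ _ _ _ _ _ _) _.
apply: sreach_trans (sreach_restore _ _ _ _ _ _ _) _.
rewrite (_ : spread_row l r (z :: s) =
  (nseq l zero_entry ++ z :: nseq r zero_entry) ++ spread_row l r s) //.
rewrite code_seq_cat code_body_cat !code_body_cons.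
move: (code_entry z) h2 {h1} => cz /= h2; rewrite size_cat !addnS -!addSn !addnA.
have := h2 (p.+1 + size cz) (out ++ code_body code_entry (nseq l zero_entry)
  ++ true :: cz ++ code_body code_entry (nseq r zero_entry)).
by rewrite !add0n -!catA /= -!catA.
Qed.

Lemma sreach_rewind pos p l l' r r' out :
  sreach (SConf Rewind (pos + p) l l' r r' p out)
    (SConf RowScan pos l l' r r' 0 (rcons out true)).
Proof.
elim: p => [|p IH]; last by rewrite addnS; apply: sreach_step IH.
by rewrite addn0; apply: sreach_step (sreach_refl _).
Qed.

(** Both [l] and [p] are lowered at each step, and one that has reached 0 stays there. Moving [l]
    over to [r] restores 2^m - 1 for the next row. *)
Lemma sreach_reset pos l l' r r' p out :
  sreach (SConf Reset pos l l' r r' p out)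
    (SConf MatScan pos.+1 0 l' (r + l) r' 0 out).
Proof.
elim: l p r => [|l IH] p r.
  rewrite addn0; elim: p => [|p IH]; last exact: sreach_step IH.
  exact: sreach_step (sreach_refl _).
by rewrite addnS -addSn; apply: sreach_step (IH p.-1 r.+1).
Qed.

(** A pass over the row raises l and lowers r by one, so l + r is invariant and induction on r works
    with l arbitrary. The [true] after [out] is the mark of the output row about to begin. *)
Lemma sreach_copies s pos l r out : reads pos (code_seq code_entry s) ->
  sreach (SConf RowScan pos l 0 r 0 0 (rcons out true))
    (SConf MatScan (pos + size (code_seq code_entry s)) 0 0 (l + r) 0 0
      (out ++ code_body (code_seq code_entry)
         [seq spread_row i (l + r - i) s | i <- iota l r.+1])).
Proof.
move=> hs; elim: r l out => [|r IH] l out.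
  apply: sreach_trans (sreach_row _ _ _ _ hs) _.
  apply: sreach_step; first by rewrite /sstep /=.
  apply: sreach_trans (sreach_reset _ _ _ _ _ _ _) _.
  rewrite add0n !addn0 size_code_seq addnS /= ?addn0 subnn code_body_cons cats0 cat_rcons.
  exact: sreach_refl.
apply: sreach_trans (sreach_row _ _ _ _ hs) _.
apply: sreach_step; first by rewrite /sstep /=.
apply: sreach_trans (sreach_rewind _ _ _ _ _ _ _) _.
apply: sreach_trans (IH _ _) _.
rewrite addSnnS /= addKn /code_body /= cat_rcons -catA.
exact: sreach_refl.
Qed.

Lemma sreach_matrix rows pos k out :
  reads pos (code_seq (code_seq code_entry) rows) ->
  sreach (SConf MatScan pos 0 0 k 0 0 out)
    (SConf MatScan (pos + size (code_seq (code_seq code_entry) rows)) 0 0 k 0 0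
       (out ++ code_seq (code_seq code_entry) (spread_rows k rows))).
Proof.
elim: rows pos out => [|s rows IH] pos out.
  move=> /reads_cons[e _]; apply: sreach_step (sreach_refl _).
  by rewrite /sstep /= e addn1 cats1.
rewrite code_seq_cons => /reads_cons[e /reads_cat[h1 /IH h2]].
apply: sreach_step; first by rewrite /sstep /= e.
apply: sreach_trans (sreach_copies _ _ _ h1) _.
rewrite (_ : spread_rows k (s :: rows) =
  [seq spread_row i (k - i) s | i <- iota 0 k.+1] ++ spread_rows k rows) //.
rewrite code_seq_cat [size (_ :: _)]/= size_cat addnS -addSn addnA catA !add0n.
exact: h2.
Qed.

Lemma sreach_matrices (rows : nat -> seq (seq (rat * rat))) k l :
  let ms f := flatten [seq code_seq (code_seq code_entry) (f i) | i <- iota 0 l] in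
  reads 0 (ms rows) ->
  sreach (SConf MatScan 0 0 0 k 0 0 [::])
    (SConf MatScan (size (ms rows)) 0 0 k 0 0 (ms (fun i => spread_rows k (rows i)))).
Proof.
move=> ms; rewrite {}/ms; elim: l => [|l IH]; first by move=> _; exact: sreach_refl.
rewrite -addn1 iotaD !map_cat !flatten_cat /= !cats0 => /reads_cat[/IH h1 h2].
by apply: sreach_trans h1 _; rewrite size_cat; apply: sreach_matrix.
Qed.

End Stream.

Definition tensor_machine (U : machine) : machine := host U PLoop tensor_ctl.

(** * The same control on the output of U as it is produced *)

Section Lazy.
Variables (U : machine) (y p : seq bool).
Local Notation r := (run U y p).

Lemma cout_step (c : config U) : prefix (cout c) (cout (step y c)).
Proof.
rewrite /step; case: caction => [|s0 s1|u d w dw o] /=; rewrite ?prefix_refl //.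
  by case: (cprog c) => [|b q]; rewrite prefix_refl.
by case: o => [b|]; rewrite ?prefix_refl ?prefix_rcons.
Qed.

Lemma cout_run t d : prefix (cout (r t)) (cout (r (d + t))).
Proof.
elim: d => [|d IH]; first exact: prefix_refl.
by apply: prefix_trans IH _; rewrite addSn /run iterS; exact: cout_step.
Qed.

Variable w : nat -> bool.
Hypothesis outP : forall t i, (i < size (cout (r t)))%N ->
  onth (cout (r t)) i = Some (w i).
Hypothesis out_inf : forall i, exists t, (i < size (cout (r t)))%N.

Let H := tensor_machine U.

Let C (x : sconf) t : config H :=
  conc PLoop tensor_ctl (sq x) (r t) (caux (r t)) (onth (cout (r t))) (spos x)
    (five (sL x) (sL' x) (sR x) (sR' x) (sP x)) (sout x).

(** The bound on [spos x] keeps the head from passing the first blank cell, the only place where an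
    emitted bit can be appended to the tape. *)
Definition lazy_reached (x : sconf) :=
  exists t, reach y (init H p) (C x t) /\ (spos x <= size (cout (r t)))%N.

(** On the first blank cell every step of the host is a step of U. The induction counts these steps,
    and [out_inf] tells how many suffice. *)
Lemma lazy_fill x : is_main (sq x) -> lazy_reached x ->
  exists t, reach y (init H p) (C x t) /\ (spos x < size (cout (r t)))%N.
Proof.
move=> qx [t [ht let_]].
have fill d : exists t', [/\ reach y (init H p) (C x t'),
   (spos x <= size (cout (r t')))%N &
   (spos x < size (cout (r t')))%N \/ t' = (d + t)%N].
  elim: d => [|d [t' [h1 h2 h3]]]; first by exists t; split => //; right.
  move: h2; rewrite leq_eqVlt => /orP[/eqP h2|h2]; last first.
    by exists t'; split; [|exact: ltnW|left].
  case: h3 => [|e]; first by rewrite h2 ltnn.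
  exists (d.+1 + t)%N; split; last by right.
  - apply: reach_trans h1 _; apply: reach_step (reach_refl _ _).
    rewrite /C h2 e addSn /run iterS; apply: step_simin.
    by case: (sq x) qx.
  - by rewrite h2 e; exact: size_prefix (cout_run _ 1).
have [u ltu] := out_inf (spos x).
have [t' [h1 _ [h2|e]]] := fill u; exists t'; split=> //.
apply: leq_trans ltu _; rewrite e addnC; exact: size_prefix (cout_run _ _).
Qed.

Lemma is_main_sstep x : is_main (sq x) -> is_main (sq (sstep w x)).
Proof.
case: x => q pos l l' rr r' s out /=; rewrite /sstep /=.
case: q => //=; try by [case: (w pos)|case: (rr == 0)|case: (s == 0)|case: (l == 0)].
- by case: (_ && _).
- by case: (_ && _).
- by move=> [] [] [] [].
- by move=> h [[]|] //=; case: (w pos) => //; case: h.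
Qed.

Lemma main_move q b z : (let: (_, dv, _, _) := main_ctl q b z in
  forall n, Defs.shift dv n <= n.+1)%N.
Proof.
have M d n : (Defs.shift d n <= n.+1)%N.
  by case: d => //=; rewrite (leq_trans (leq_pred n)).
by case: main_ctl => -[[q' dv] dk] o n.
Qed.

Lemma lazy_sstep x : is_main (sq x) -> lazy_reached x -> lazy_reached (sstep w x).
Proof.
move=> qx /(lazy_fill qx) [t [ht lt_]].
exists t; split; last first.
  rewrite /sstep; move: (main_move (sq x) (w (spos x))
    (five (sL x == 0) (sL' x == 0) (sR x == 0) (sR' x == 0) (sP x == 0))).
  by case: main_ctl => -[[q' dv] dk] o /= /(_ (spos x)) h; apply: leq_trans h lt_.
apply: reach_trans ht _; apply: reach_step (reach_refl _ _).
rewrite /C /sstep; case E: main_ctl => [[[q' dv] dk] o] /=.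
apply: step_own.
  rewrite (outP lt_) five_zero.
  rewrite (_ : tensor_ctl _ _ _ _ = let: (q', dv, dk, o) :=
     main_ctl (sq x) (w (spos x)) (five (sL x == 0) (sL' x == 0) (sR x == 0)
       (sR' x == 0) (sP x == 0)) in Own q' Stay (Some (w (spos x))) dv dk o).
    by rewrite E.
  by case: (sq x) qx.
rewrite -(outP lt_) onth_id; congr conc.
by apply/funext => -[[[] []]|].
Qed.

Lemma lazy_sreach x x' : is_main (sq x) -> lazy_reached x -> sreach w x x' ->
  lazy_reached x'.
Proof.
move=> qx hx [t <-].
suff [] : is_main (sq (iter t (sstep w) x)) /\ lazy_reached (iter t (sstep w) x) by [].
elim: t => //= t [IH1 IH2]; split; first exact: is_main_sstep.
exact: lazy_sstep.
Qed.

End Lazy.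

(** * Computing 2^m - 1 from the auxiliary tape *)

Section Prelude.
Variables (U : machine) (y : seq bool) (c : config U) (v : nat -> option bool).

Let C q aux l' r r' s : config (tensor_machine U) :=
  conc PLoop tensor_ctl q c aux v 0 (five 0 l' r r' s) [::].

Lemma step_prelude q aux l' r r' s q' da dk aux' l'1 r1 r'1 s1 :
  tensor_ctl q (onth y aux) (v 0)
    (five true (l' == 0) (r == 0) (r' == 0) (s == 0)) =
    Own q' da (v 0) Stay dk None ->
  Defs.shift da aux = aux' ->
  (forall k, Defs.shift (dk k) (five 0 l' r r' s k) = five 0 l'1 r1 r'1 s1 k) ->
  step y (C q aux l' r r' s) = C q' aux' l'1 r1 r'1 s1.
Proof.
move=> e e1 e2; apply: step_own; first by rewrite five_zero e.
by rewrite onth_id e1; congr conc; apply/funext.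
Qed.

Ltac prel := by apply: step_prelude; [rewrite /=|rewrite /=|case=> [[[] []]|]].

Lemma reach_double aux l' r r' s :
  reach y (C PDouble aux l' r r' s) (C PBack aux (l' + r) 0 (r' + r) s).
Proof.
elim: r l' r' => [|r IH] l' r'.
  by rewrite !addn0; apply: reach_step (reach_refl _ _); prel.
by rewrite !addnS -!addSn; apply: reach_step (IH _ _); prel.
Qed.

Lemma reach_back aux l' r r' s :
  reach y (C PBack aux l' r r' s) (C PLoop aux.+1 0 (r + l' + r').+1 0 s.+1).
Proof.
elim: l' r => [|l' IH] r; last first.
  by rewrite -addSnnS; apply: reach_step (IH _); prel.
rewrite addn0; elim: r' r => [|r' IH] r.
  by rewrite addn0; apply: reach_step (reach_refl _ _); prel.
by rewrite -addSnnS; apply: reach_step (IH _); prel.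
Qed.

(** In this phase [cP] counts cells of the auxiliary tape: U shares that head with the host and must
    find it in cell 0. *)
Lemma reach_prewind aux r :
  reach y (C PRewind aux 0 r 0 aux) (C MatScan 0 0 r 0 0).
Proof.
elim: aux => [|aux IH]; first by apply: reach_step (reach_refl _ _); prel.
by apply: reach_step IH; prel.
Qed.

(** Each mark turns r into 2r + 1, that is, doubles r + 1. *)
Lemma reach_pow2 k rest aux r : drop aux y = code_nat k ++ rest ->
  reach y (C PLoop aux 0 r 0 aux) (C MatScan 0 0 (2 ^ k * r.+1).-1 0 0).
Proof.
elim: k aux r => [|k IH] aux r.
  move=> /drop_code_nat0[e _]; rewrite mul1n /=.
  apply: reach_step (reach_prewind _ _).
  by apply: step_prelude; [rewrite /= e|rewrite /=|case=> [[[] []]|]].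
move=> /drop_code_natS[e /IH h].
apply: (@reach_step _ _ _ (C PDouble aux 0 r 0 aux)).
  by apply: step_prelude; [rewrite /= e|rewrite /=|case=> [[[] []]|]].
apply: reach_trans (reach_double _ _ _ _ _) _.
apply: reach_trans (reach_back _ _ _ _ _) _.
have := h (0 + (0 + r) + (0 + r)).+1.
suff -> : (2 ^ k * (0 + (0 + r) + (0 + r)).+2 = 2 ^ k.+1 * r.+1)%N by [].
by rewrite !add0n expnSr -mulnA mul2n doubleS addnn.
Qed.

End Prelude.

Lemma size_flatten_ge (f : nat -> seq bool) l :
  (forall i, 0 < size (f i))%N -> (l <= size (flatten [seq f i | i <- iota 0 l]))%N.
Proof.
move=> f0; elim: l => // l IH; rewrite -addn1 iotaD map_cat flatten_cat size_cat /=.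
by rewrite cats0 add0n leq_add.
Qed.

Lemma nth_prefix (T : Type) (x0 : T) (s1 s2 : seq T) i :
  (exists s, s2 = s1 ++ s) -> (i < size s1)%N -> nth x0 s1 i = nth x0 s2 i.
Proof. by move=> [s ->] lti; rewrite nth_cat lti. Qed.

(** Codes are nonempty, so the emitted initial segments are unboundedly long; as outputs only grow,
    they determine the whole output. *)
Lemma emits_stream (U : machine) (y p : seq bool) (f : nat -> seq bool) :
  (forall i, 0 < size (f i))%N ->
  (forall l, emits U y p (flatten [seq f i | i <- iota 0 l])) ->
  exists w : nat -> bool,
  [/\ forall t i, (i < size (cout (run U y p t)))%N ->
        onth (cout (run U y p t)) i = Some (w i),
      forall i, exists t, (i < size (cout (run U y p t)))%N &
      forall l, reads w 0 (flatten [seq f i | i <- iota 0 l])].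
Proof.
move=> f0 hf; pose P l := flatten [seq f i | i <- iota 0 l].
have sP l : (l <= size (P l))%N by exact: size_flatten_ge.
have PD l d : exists s, P (l + d) = P l ++ s.
  by exists (flatten [seq f i | i <- iota l d]); rewrite /P iotaD map_cat flatten_cat.
(* [P i.+1] has more than i bits, so the default is never taken. *)
pose w i := nth false (P i.+1) i.
have Pw l i : (i < size (P l))%N -> nth false (P l) i = w i.
  move=> lti; have := leq_total l i.+1 => /orP[] /subnKC e.
    by rewrite /w; apply: nth_prefix => //; rewrite -e.
  by rewrite /w; apply/esym/nth_prefix => //; rewrite -e.
exists w; split.
(* Take as many codes as there are bits at time t: they cover position i, and they are all output at
   some t', whose output is comparable with that at t. *)
- move=> t i lti; have [t' /prefixP[s es]] := hf (size (cout (run U y p t))).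
  rewrite -/(P _) in es; set l := size _ in es lti sP.
  have ltP : (i < size (P l))%N by exact: leq_trans lti (sP l).
  have lt2 : (i < size (cout (run U y p t')))%N.
    by rewrite es size_cat ltn_addr.
  suff e : nth false (cout (run U y p t)) i = w i.
    by rewrite -e onthE (nth_map false).
  rewrite -(Pw l) // (@nth_prefix _ _ (P l) (cout (run U y p t'))) //; last by exists s.
  case/orP: (leq_total t t') => /subnK <-.
    by apply: nth_prefix => //; apply/prefixP; exact: cout_run.
  by apply/esym/nth_prefix => //; apply/prefixP; exact: cout_run.
- move=> i; have [t hp] := hf i.+1; exists t.
  exact: leq_trans (sP _) (size_prefix hp).
- by move=> l i lti; rewrite add0n -(Pw l).
Qed.

Lemma tensor_machine_emits U m rest p (s : nat -> seq (seq (rat * rat))) :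
  let y := code_nat m ++ rest in
  let ms f := fun l =>
    flatten [seq code_seq (code_seq code_entry) (f i) | i <- iota 0 l] in
  (forall l, emits U y p (ms s l)) ->
  forall l, emits (tensor_machine U) y p (ms (fun i => spread_rows (2 ^ m).-1 (s i)) l).
Proof.
move=> y ms hs l.
have [||w [h1 h2 h3]] := @emits_stream U y p
  (fun i => code_seq (code_seq code_entry) (s i)); [|exact: hs|].
  by move=> i; rewrite size_code_seq.
have start : lazy_reached U y p (SConf MatScan 0 0 0 (2 ^ m).-1 0 0 [::]).
  exists 0; split => //=; apply: reach_step; first exact: step_host_init.
  rewrite (_ : (fun=> None) = onth [::]); last by apply/funext => i; rewrite onth0n.
  rewrite -(muln1 (2 ^ m)); apply: (@reach_pow2 U y _ _ m rest 0 0).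
  by rewrite drop0.
have qx : is_main (sq (SConf MatScan 0 0 0 (2 ^ m).-1 0 0 [::])) by [].
have [t [[u hu] _]] := lazy_sreach h1 h2 qx start
  (sreach_matrices (2 ^ m).-1 (h3 l)).
by exists u; rewrite /run hu /= prefix_refl.
Qed.

Import Order.TTheory GRing.Theory Num.Theory.
Import numFieldNormedType.Exports.
Local Open Scope classical_set_scope.
Local Open Scope ring_scope.

(** * Partial traces and A (x) I *)

Lemma map_allpairs_code (p q : nat) :
  [seq (x * q + a)%N | x <- iota 0 p, a <- iota 0 q] = iota 0 (p * q).
Proof.
elim: p => [|p IH]; first by rewrite mul0n.
rewrite mulSnr iotaD -IH -addn1 iotaD allpairs_cat /= cats0 !add0n.
by rewrite -[in RHS](addn0 (p * q)%N) iotaDl.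
Qed.

(** [mxvec_index] is a rank in the enumeration of pairs; listing that enumeration through i * q + j
    gives 0, 1, 2, and so on. *)
Lemma mxvec_index_val (p q : nat) (i : 'I_p) (j : 'I_q) :
  mxvec_index i j = (i * q + j)%N :> nat.
Proof.
pose g (x : 'I_p * 'I_q) := (x.1 * q + x.2)%N.
have eg : map g (enum {: 'I_p * 'I_q}) = iota 0 (p * q).
  rewrite enumT Finite.enum.unlock /= /prod_enum map_allpairs.
  rewrite -map_allpairs_code -(val_enum_ord p) -(val_enum_ord q).
  by rewrite allpairs_mapl allpairs_mapr.
rewrite -[RHS]/(g (i, j)) -[in RHS](enum_rankK (i, j)) (enum_val_nth (i, j)) /=.
have lti : (enum_rank (i, j) < p * q)%N.
  by rewrite (leq_trans (ltn_ord _)) // card_prod !card_ord.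
rewrite -(nth_map _ 0%N) ?eg ?nth_iota //.
by rewrite -cardE; exact: ltn_ord.
Qed.

Section Tensor.
Variables (m n : nat) (le_mn : (m <= n)%N).
Local Notation N := (2 ^ n)%N.
Local Notation M := (2 ^ m)%N.
Local Notation L := (2 ^ (n - m))%N.
Local Notation ti := (tensor_index le_mn).

Lemma tensor_index_val i a : ti i a = (i * M + a)%N :> nat.
Proof. exact: mxvec_index_val. Qed.

Lemma tensor_hi_subproof (x : 'I_N) : (x %/ M < L)%N.
Proof. by rewrite ltn_divLR ?expn_gt0 // tensor_dim. Qed.

Lemma tensor_lo_subproof (x : 'I_N) : (x %% M < M)%N.
Proof. by rewrite ltn_mod expn_gt0. Qed.

Definition tensor_hi x : 'I_L := Ordinal (tensor_hi_subproof x).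
Definition tensor_lo x : 'I_M := Ordinal (tensor_lo_subproof x).

Lemma tensor_hiK i a : tensor_hi (ti i a) = i.
Proof.
apply/val_inj; change ((ti i a : nat) %/ M = i)%N; rewrite tensor_index_val.
by rewrite divnMDl ?expn_gt0 // divn_small // addn0.
Qed.

Lemma tensor_loK i a : tensor_lo (ti i a) = a.
Proof.
apply/val_inj; change ((ti i a : nat) %% M = a)%N; rewrite tensor_index_val.
by rewrite modnMDl modn_small.
Qed.

Lemma tensor_indexK x : ti (tensor_hi x) (tensor_lo x) = x.
Proof. by apply/val_inj; rewrite [LHS]tensor_index_val /= -divn_eq. Qed.

Lemma sum_tensor_index (V : nmodType) (F : 'I_N -> V) :
  \sum_x F x = \sum_i \sum_a F (ti i a).
Proof.
rewrite pair_big /= (reindex (fun p => ti p.1 p.2)) //=.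
exists (fun x => (tensor_hi x, tensor_lo x)) => [[i a]|x] _ /=.
  by rewrite tensor_hiK tensor_loK.
exact: tensor_indexK.
Qed.

Lemma enum_tensor_index :
  enum 'I_N = [seq ti i a | i <- enum 'I_L, a <- enum 'I_M].
Proof.
apply: (inj_map val_inj); rewrite val_enum_ord map_allpairs.
rewrite -[in LHS](tensor_dim le_mn) -map_allpairs_code.
rewrite -(val_enum_ord L) -(val_enum_ord M) allpairs_mapl allpairs_mapr.
by apply: eq_allpairs => i a; exact/esym/tensor_index_val.
Qed.

(* [tensor_id 0 A] is the matrix A (x) I. *)
Definition tensor_id (T : Type) (z : T) (A : 'M[T]_L) : 'M[T]_N :=
  \matrix_(x, y) if tensor_lo x == tensor_lo y then A (tensor_hi x) (tensor_hi y)
                 else z.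

Lemma tensor_idE T (z : T) A i a j b :
  tensor_id z A (ti i a) (ti j b) = if a == b then A i j else z.
Proof. by rewrite mxE !tensor_hiK !tensor_loK. Qed.

Lemma tensor_id_inj T (z : T) : injective (tensor_id z).
Proof.
move=> A B eAB; apply/matrixP => i j.
have M0 : (0 < M)%N by rewrite expn_gt0.
have := congr1 (fun X : 'M[T]_N => X (ti i (Ordinal M0)) (ti j (Ordinal M0))) eAB.
by rewrite !tensor_idE eqxx.
Qed.

Definition mxrows (T : Type) (K : nat) (A : 'M[T]_K) : seq (seq T) :=
  [seq [seq A i j | j <- enum 'I_K] | i <- enum 'I_K].

Lemma map_iota_const (T : Type) (f : nat -> T) c i k :
  (forall b, (i <= b < i + k)%N -> f b = c) -> map f (iota i k) = nseq k c.
Proof.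
elim: k i => //= k IH i fc; rewrite fc ?IH //.
  by move=> b /andP[leb ltb]; rewrite fc // ltnW //= -addSnnS.
by rewrite leqnn -addSnnS leq_addr.
Qed.

Lemma map_delta_iota (T : Type) (z0 z : T) (K a : nat) : (a < K)%N ->
  [seq if a == b then z else z0 | b <- iota 0 K] =
  nseq a z0 ++ z :: nseq (K.-1 - a) z0.
Proof.
case: K => // K lea.
have e : K.+1 = (a + (1 + (K - a)))%N by rewrite add1n addnS subnKC // -ltnS.
rewrite [in LHS]e !iotaD !map_cat [map _ (iota _ 1)]/= add0n eqxx.
congr (_ ++ _ :: _); apply: map_iota_const => b.
  by rewrite add0n => /andP[_ /gtn_eqF ->].
by rewrite addn1 => /andP[/ltn_eqF -> _].
Qed.

Lemma map_delta_enum (T : Type) (z0 z : T) (K : nat) (a : 'I_K) :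
  [seq if a == b then z else z0 | b <- enum 'I_K] =
  nseq a z0 ++ z :: nseq (K.-1 - a) z0.
Proof.
rewrite -map_delta_iota // -val_enum_ord -[RHS]map_comp.
by apply: eq_map => b /=; rewrite val_eqE.
Qed.

(** In row (i, a) the columns (j, b) run with b fastest; for fixed j they hold A i j at b = a and
    zeros elsewhere, which is one block of [spread_row]. *)
Lemma mxrows_tensor_id (A : 'M[rat * rat]_L) :
  mxrows (tensor_id zero_entry A) = spread_rows M.-1 (mxrows A).
Proof.
have eM : M.-1.+1 = M by rewrite prednK // expn_gt0.
rewrite /mxrows /spread_rows eM -[in RHS]map_comp enum_tensor_index map_allpairs.
congr flatten; apply: eq_map => i; rewrite [RHS]/=.
rewrite -val_enum_ord -[RHS]map_comp; apply: eq_map => a.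
rewrite [RHS]/= /spread_row -[in RHS]map_comp map_allpairs.
congr flatten; apply: eq_map => j; rewrite [RHS]/= -map_delta_enum.
by apply: eq_map => b; exact: tensor_idE.
Qed.

Variable R : realType.

Lemma trace_tensor_id (A : 'M[R[i]]_L) (B : 'M[R[i]]_N) :
  \tr (tensor_id 0 A *m B) = \tr (A *m partial_trace le_mn B).
Proof.
rewrite /mxtrace sum_tensor_index; apply: eq_bigr => i _.
under eq_bigr => a _ do rewrite mxE sum_tensor_index.
rewrite mxE exchange_big /=; apply: eq_bigr => j _.
rewrite mxE mulr_sumr; apply: eq_bigr => a _.
rewrite (bigD1 a) //= tensor_idE eqxx big1 ?addr0 // => b nab.
by rewrite tensor_idE eq_sym (negbTE nab) mul0r.
Qed.

Lemma hermsymP (K : nat) (A : 'M[R[i]]_K) :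
  A \is hermsymmx <-> forall i j, A i j = Num.conj (A j i).
Proof.
split=> [/is_hermitianmxP|] h; first by move=> i j; rewrite [in LHS]h !mxE expr0 mul1r.
by apply/is_hermitianmxP/matrixP => i j; rewrite h !mxE expr0 mul1r.
Qed.

(** Cut v into 2^m slices by the second index: the quadratic form of A (x) I at v is the sum of
    those of A at the slices. *)
Lemma psdmx_tensor_id (A : 'M[R[i]]_L) : psdmx A -> psdmx (tensor_id 0 A).
Proof.
move=> [/hermsymP hA pA]; split.
  apply/hermsymP => x y; rewrite -(tensor_indexK x) -(tensor_indexK y) !tensor_idE.
  by rewrite eq_sym; case: eqP => _; rewrite ?conjC0 // hA.
move=> v; rewrite mxE sum_tensor_index exchange_big /=; apply: sumr_ge0 => b _.
have := pA (\row_i v 0 (ti i b)); rewrite mxE.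
congr (0 <= _); apply: eq_bigr => j _; rewrite !mxE; congr (_ * _).
rewrite sum_tensor_index; apply: eq_bigr => i _; rewrite mxE.
rewrite (bigD1 b) //= tensor_idE eqxx big1 ?addr0 // => a nab.
by rewrite tensor_idE (negbTE nab) mulr0.
Qed.

Lemma elementary_tensor_id (A : 'M[rat * rat]_L) :
  elementary_mx R (tensor_id zero_entry A) = tensor_id 0 (elementary_mx R A).
Proof.
apply/matrixP => x y; rewrite !mxE; case: eqP => _; rewrite ?mxE //=.
by rewrite raddf0.
Qed.

Lemma tensor_idB (A B : 'M[R[i]]_L) :
  tensor_id 0 A - tensor_id 0 B = tensor_id 0 (A - B).
Proof. by apply/matrixP => x y; rewrite !mxE; case: eqP; rewrite ?subr0. Qed.

Lemma mx_cvg_tensor_id (s : nat -> 'M[R[i]]_L) A :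
  mx_cvg s A -> mx_cvg (fun l => tensor_id 0 (s l)) (tensor_id 0 A).
Proof.
move=> h x y; rewrite mxE.
under [X in X @ _ --> _ /\ _]eq_fun do rewrite mxE.
under [X in _ /\ X @ _ --> _]eq_fun do rewrite mxE.
by case: eqP => _; [exact: h|split; exact: cvg_cst].
Qed.

End Tensor.

(** * Traces of products of positive semidefinite matrices *)

Section PsdTrace.
Variables (R : realType) (K : nat).
Implicit Types A B : 'M[R[i]]_K.

(** Diagonalise B by a unitary P. The trace becomes the sum of the diagonal entries of P A P^-1
    times the eigenvalues of B, and both factors are values of the quadratic forms at the rows of
    P. *)
Lemma psd_trace_ge0 A B : psdmx A -> psdmx B -> 0 <= \tr (A *m B).
Proof.
move=> [_ pA] [hB pB].
pose P := spectralmx B; pose d := spectral_diag B.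
have Pu : P \is unitarymx := spectral_unitarymx B.
have eB : B = invmx P *m diag_mx d *m P.
  by apply/orthomx_spectralP; exact: hermitian_normalmx.
have q (C : 'M[R[i]]_K) i :
    (P *m C *m invmx P) i i = (row i P *m C *m map_mx Num.conj (row i P)^T) 0 0.
  rewrite invmx_unitary // -row_mul !mxE; apply: eq_bigr => j _.
  by rewrite !mxE.
have dE i : d 0 i = (P *m B *m invmx P) i i.
  rewrite eB !mulmxA mulmxV ?unitarymx_unit // mul1mx -mulmxA mulmxV ?unitarymx_unit //.
  by rewrite mulmx1 mxE eqxx.
rewrite eB !mulmxA mxtrace_mulC !mulmxA; apply: sumr_ge0 => i _.
rewrite mul_mx_diag mxE mulr_ge0 //; first by rewrite q; exact: pA.
by rewrite dE q; exact: pB.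
Qed.

Lemma Re_sum (I : Type) (r : seq I) (F : I -> R[i]) :
  complex.Re (\sum_(i <- r) F i) = \sum_(i <- r) complex.Re (F i).
Proof. by apply: (big_morph (@complex.Re R)) => // -[? ?] [? ?]. Qed.

Lemma cvg_Re_trace (s : nat -> 'M[R[i]]_K) A B : mx_cvg s A ->
  (fun l => complex.Re (\tr (s l *m B))) @ \oo --> complex.Re (\tr (A *m B)).
Proof.
move=> h.
have e (C : 'M[R[i]]_K) : complex.Re (\tr (C *m B)) = \sum_i \sum_j
   (complex.Re (C i j) * complex.Re (B j i) - complex.Im (C i j) * complex.Im (B j i)).
  rewrite /mxtrace Re_sum; apply: eq_bigr => i _.
  rewrite mxE Re_sum; apply: eq_bigr => j _.
  by case: (C i j) => ? ?; case: (B j i).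
rewrite e; under eq_fun do rewrite e.
apply: cvg_big => [|i _]; first exact: add_continuous.
apply: cvg_big => [|j _]; first exact: add_continuous.
by apply: cvgB; apply: cvgMl; have [] := h i j.
Qed.

End PsdTrace.

(** * Universal probabilities *)

Section LowerProb.
Variables (R : realType) (U : machine).

Lemma lower_computes_tensor_id t2 m n (le_mn : (m <= n)%N) q
    (nu : 'M[R[i]]_(2 ^ (n - m))) :
  let e := code_nat m ++ code_nat n in
  (forall y p w, emits (tensor_machine U) y p w -> emits U y (t2 ++ p) w) ->
  lower_computes U e q nu ->
  lower_computes U e (t2 ++ q) (tensor_id le_mn 0%R nu).
Proof.
move=> e ht [s [hs psd_s mono_s cvg_s]].
exists (fun l => tensor_id le_mn zero_entry (s l)); split.
- move=> l; apply: ht.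
  have := @tensor_machine_emits U m (code_nat n) q (fun i => mxrows (s i)) hs l.
  by under eq_map do rewrite -(mxrows_tensor_id le_mn).
- by move=> l; rewrite elementary_tensor_id; exact: psdmx_tensor_id.
- by move=> l; rewrite !elementary_tensor_id tensor_idB; exact: psdmx_tensor_id.
- under [X in mx_cvg X]eq_fun do rewrite elementary_tensor_id.
  exact: mx_cvg_tensor_id.
Qed.

Lemma Re_trace_lower_ge0 e q (K : nat) (nu sigma : 'M[R[i]]_K) :
  lower_computes U e q nu -> psdmx sigma -> 0 <= complex.Re (\tr (nu *m sigma)).
Proof.
move=> [s [_ psd_s _ /cvg_Re_trace cv]] psd_sigma.
rewrite -(cvg_lim (@Rhausdorff R) (cv sigma)).
apply: limr_ge; first by apply/cvg_ex; eexists; exact: cv.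
by apply: nearW => l; have := psd_trace_ge0 (psd_s l) psd_sigma; rewrite lecE => /andP[].
Qed.

Local Open Scope ereal_scope.

(** This compares the sums over p, q and nu alike, with f prepending t1, prepending t2, and
    tensoring with I. By injectivity a finite set of indices on the left maps to one of equal size
    on the right. *)
Lemma le_esum_inj (T T' : choiceType) (P : set T) (Q : set T') (f : T -> T')
    (a : T -> \bar R) (b : T' -> \bar R) (C : R) :
  (0 <= C)%R -> injective f -> (forall i, P i -> Q (f i)) ->
  (forall i, P i -> 0 <= b (f i)) ->
  (forall i, P i -> a i <= C%:E * b (f i)) ->
  \esum_(i in P) a i <= C%:E * \esum_(j in Q) b j.
Proof.
move=> C0 fI PQ b0 ab; apply: ge_ereal_sup => _ [X [finX XP] <-].
apply: (@le_trans _ _ (\sum_(i \in X) C%:E * b (f i))).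
  by apply: lee_fsum => // i /XP; exact: ab.
have -> : \sum_(i \in X) C%:E * b (f i) = C%:E * \sum_(i \in X) b (f i).
  rewrite !fsbig_finite // big_seq [in RHS]big_seq ge0_sume_distrr // => i.
  by rewrite in_fset_set // inE => /XP; exact: b0.
apply: lee_wpmul2l; first by rewrite lee_fin.
apply: ereal_sup_ubound; exists (f @` X).
  by split; [exact: finite_image|move=> _ [i /XP /PQ Qi <-]].
by rewrite fsbig_image // => i j _ _; exact: fI.
Qed.

Lemma univ_prob_ge0 x y : 0 <= univ_prob R U x y.
Proof. by apply: esum_ge0 => p _; rewrite lee_fin invr_ge0 exprn_ge0. Qed.

Lemma lower_prob_ge0 e (K : nat) (nu : 'M[R[i]]_K) y : 0 <= lower_prob U e nu y.
Proof. by apply: esum_ge0 => q _; exact: univ_prob_ge0. Qed.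

Lemma univ_prob_prefix t1 x x' y y' :
  (forall p, computes U y p x -> computes U y' (t1 ++ p) x') ->
  univ_prob R U x y <= (2 ^+ size t1)%:E * univ_prob R U x' y'.
Proof.
move=> h; apply: (@le_esum_inj _ _ _ _ (cat t1)).
- exact: exprn_ge0.
- by move=> p q /eqP; rewrite eqseq_cat // eqxx => /eqP.
- exact: h.
- by move=> p _; rewrite lee_fin invr_ge0 exprn_ge0.
- by move=> p _; rewrite -EFinM lee_fin size_cat exprD invfM mulrA mulfV ?mul1r //.
Qed.

Lemma lower_prob_tensor_id t1 t2 m n (le_mn : (m <= n)%N)
    (nu : 'M[R[i]]_(2 ^ (n - m))) :
  let e := code_nat m ++ code_nat n in
  (forall y p x, computes (aux_machine U t2) y p x -> computes U y (t1 ++ p) x) ->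
  (forall y p w, emits (tensor_machine U) y p w -> emits U y (t2 ++ p) w) ->
  lower_prob U e nu (code_nat (n - m)) <=
  (2 ^+ size t1)%:E * lower_prob U e (tensor_id le_mn 0%R nu) (code_nat n).
Proof.
move=> e h1 h2; apply: (@le_esum_inj _ _ _ _ (cat t2)).
- exact: exprn_ge0.
- by move=> p q /eqP; rewrite eqseq_cat // eqxx => /eqP.
- by move=> q; exact: lower_computes_tensor_id.
- by move=> q _; exact: univ_prob_ge0.
- move=> q _; apply: univ_prob_prefix => p hp; apply: h1.
  exact: (aux_machine_computes _ le_mn (erefl e) hp).
Qed.

Lemma trace_test_partial_trace t1 t2 m n (le_mn : (m <= n)%N)
    (sigma rho : 'M[R[i]]_(2 ^ n)) :
  let e := code_nat m ++ code_nat n in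
  (forall y p x, computes (aux_machine U t2) y p x -> computes U y (t1 ++ p) x) ->
  (forall y p w, emits (tensor_machine U) y p w -> emits U y (t2 ++ p) w) ->
  psdmx sigma ->
  trace_test U e (partial_trace le_mn sigma) (partial_trace le_mn rho) <=
  (2 ^+ size t1)%:E * trace_test U e sigma rho.
Proof.
move=> e h1 h2 psd_sigma.
(* The bound on lower probabilities is multiplied by these traces; their sign comes from the
   positivity of sigma. *)
have tr0 nu : tests U e (partial_trace le_mn rho) nu ->
    (0 <= complex.Re (\tr (tensor_id le_mn 0%R nu *m sigma)))%R.
  by move=> [[q hq] _]; apply: Re_trace_lower_ge0 (lower_computes_tensor_id _ h2 hq) _.
apply: (@le_esum_inj _ _ _ _ (tensor_id le_mn 0%R)).
- exact: exprn_ge0.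
- exact: tensor_id_inj.
- move=> nu [[q hq] tr1]; split; last by rewrite trace_tensor_id.
  by exists (t2 ++ q); exact: lower_computes_tensor_id.
- by move=> nu /tr0 ?; rewrite mule_ge0 ?lee_fin // lower_prob_ge0.
- move=> nu /tr0 tr_ge0; rewrite -trace_tensor_id muleA.
  by apply: lee_wpmul2r; [rewrite lee_fin|exact: (lower_prob_tensor_id _ _ h1 h2)].
Qed.

Lemma trace_test_ge0 e k (sigma rho : 'M[R[i]]_(2 ^ k)) :
  0 <= trace_test U e sigma rho.
Proof.
(* The empty sum is among the finite sums whose supremum is taken. *)
apply: ereal_sup_ubound; exists set0; first exact: fsets_set0.
by rewrite fsbig_set0.
Qed.

End LowerProb.

Lemma lne_le_shift (R : realType) (k : nat) (x y : \bar R) :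
  (0 <= x)%E -> (0 <= y)%E -> (x <= (2 ^+ k)%:E * y)%E ->
  (lne x * (ln 2)^-1%:E <= lne y * (ln 2)^-1%:E + k%:R%:E)%E.
Proof.
move=> x0 y0 le_xy.
have ln2 : 0 < ln 2 :> R by rewrite ln_gt0 // ltr1n.
have : (lne x <= lne ((2 ^+ k)%:E * y))%E.
  by rewrite lee_lne // in_itv /= leey andbT ?mule_ge0 // lee_fin exprn_ge0.
(* At y = 0 the logarithm of a product does not split; there [lne x] is forced to be -oo. *)
have [->|yn0] := eqVneq y 0%E.
  rewrite mule0 [lne 0%E]le0_lneNy // leeNy_eq => /eqP ->.
  by rewrite mulNyr gtr0_sg ?invr_gt0 // mul1e.
have yp : (0 < y)%E by rewrite lt_neqAle eq_sym yn0.
have yI : y \in `]0%E, +oo%E] by rewrite in_itv /= leey yp.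
have kI : (2 ^+ k : R)%:E \in `]0%E, +oo%E] .
  by rewrite in_itv /= leey lte_fin exprn_gt0.
rewrite lneM //.
rewrite lne_EFin ?exprn_gt0 // lnXn // => h.
have -> : k%:R%:E = ((ln (2 : R) *+ k)%:E * (ln 2)^-1%:E)%E.
  by rewrite -EFinM -[ln 2 *+ k]mulr_natl mulfK // gt_eqF.
rewrite addeC -muleDl //.
by apply: lee_wpmul2r h; rewrite lee_fin invr_ge0 ltW.
Qed.

Theorem theorem3 (R : realType) (U : machine) (univU : universal U) :
  exists c : R, forall (m n : nat) (lt_mn : (m < n)%N)
    (sigma rho : 'M[R[i]]_(2 ^ n)),
    semidensity sigma -> semidensity rho ->
    (deficiency U (code_nat m ++ code_nat n)
       (partial_trace (ltnW lt_mn) sigma) (partial_trace (ltnW lt_mn) rho)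
     <= deficiency U (code_nat m ++ code_nat n) sigma rho + c%:E)%E.
Proof.
have [t2 h2] := univU (tensor_machine U).
have [t1 h1] := univU (aux_machine U t2).
exists (size t1)%:R => m n lt_mn sigma rho [psd_sigma _] _.
apply: lne_le_shift; rewrite ?trace_test_ge0 //.
apply: (@trace_test_partial_trace _ _ t1 t2) => //.
- by move=> y p x hx; apply/(proj1 (h1 y p) x).
- by move=> y p w hw; apply/(proj2 (h2 y p) w).
Qed.
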